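(* Let $\mathbb{K}$ be a field and let $R=\mathbb{K}[x_1,\dots,x_k]$ be graded by $W=[d_1,\dots,d_k]$, where the $d_i$ are positive integers with $\gcd(d_1,\dots,d_k)=1$. Let $P_R^W$ be the Hilbert quasi-polynomial of $(R,W)$, and let $$\delta=\max\{|I| \mid I\subseteq\{1,\dots,k\},\ \gcd(d_i)_{i\in I}\neq 1\}.$$ Then $$P_R^W(x)=Q(x)+R(x),$$ where $Q(x)\in\mathbb{Q}[x]$ is a polynomial of degree $k-1$, whereas $R(x)$ is a quasi-polynomial with rational coefficients of degree $\delta-1$.
   Context: The grading by $W$ is $\deg(x_1^{\alpha_1}\cdots x_k^{\alpha_k})=d_1\alpha_1+\cdots+d_k\alpha_k$, and the Hilbert function is $H_R^W(n)=\dim_{\mathbb{K}}(R_n)$. Let $d=\operatorname{lcm}(d_1,\dots,d_k)$. A quasi-polynomial of period $d$ is a $d$-tuple $\{p_0,\dots,p_{d-1}\}$ of polynomials in $\mathbb{Q}[x]$, evaluated at $n$ as $p_i(n)$ for $n\equiv i\bmod d$; its degree is the maximum of the degrees of the $p_i$, and a polynomial is regarded as the quasi-polynomial all of whose components are equal to it (sums are componentwise). The Hilbert quasi-polynomial of $(R,W)$ is the unique quasi-polynomial $P_R^W=\{P_0,\dots,P_{d-1}\}$ of period $d$ such that $H_R^W(n)=P_R^W(n)$ for all sufficiently large $n$. Conventions: if all $d_i=1$ then $\delta=0$, and a quasi-polynomial of degree $-1$ means the zero quasi-polynomial. (The symbol $R(x)$ for the quasi-polynomial is unrelated to the ring $R$.)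 *)

(* Defs.v *)
From HB Require Import structures.
From mathcomp Require Import all_boot all_order all_algebra.
From mathcomp Require Import mpoly.

Set Implicit Arguments.
Unset Strict Implicit.
Unset Printing Implicit Defensive.

Import Order.TTheory GRing.Theory Num.Theory.
Local Open Scope ring_scope.

Section WeightedGrading.
Variables (k : nat) (d : 'I_k -> nat).

Definition wdeg (m : 'X_{1..k}) : nat := (\sum_(i < k) d i * m i)%N.

Lemma wdeg0 : wdeg 0%MM = 0%N.
Proof. by rewrite /wdeg big1 // => i _; rewrite mnmE muln0. Qed.

Lemma wdegD : {morph wdeg : m1 m2 / (m1 + m2)%MM >-> (m1 + m2)%N}.
Proof.
move=> m1 m2; rewrite /wdeg -big_split.
by apply: eq_bigr => i _; rewrite mnmDE mulnDr.
Qed.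

HB.instance Definition _ := isMeasure.Build k wdeg wdeg0 wdegD.

Definition wgcd : nat := \big[gcdn/0%N]_(i < k) d i.

Definition wlcm : nat := \big[lcmn/1%N]_(i < k) d i.

(* The gcd over the empty set is 0, so I = set0 always satisfies the condition
   and wdelta = 0 when all the weights are 1. *)
Definition wdelta : nat :=
  (\max_(I : {set 'I_k} | \big[gcdn/0%N]_(i in I) d i != 1%N) #|I|)%N.

End WeightedGrading.

(* The homogeneous component R_n of R = K[x_1, ..., x_k].  The positivity of the
   weights is a parameter of the type because it makes R_n finite-dimensional,
   so that R_n can carry a canonical vectType structure. *)
Record grcomp (K : fieldType) (k : nat) (d : 'I_k -> nat)
    (d_gt0 : forall i, (0 < d i)%N) (n : nat) : predArgType := GrComp {
  mpoly_of_grcomp :> {mpoly K[k]};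
  _ : mpoly_of_grcomp \is n.-homog for (wdeg d) }.

Section GradedComponent.
Variables (K : fieldType) (k : nat) (d : 'I_k -> nat).
Variables (d_gt0 : forall i, (0 < d i)%N) (n : nat).

Local Notation R_n := (grcomp K d_gt0 n).

HB.instance Definition _ := [isSub of R_n for @mpoly_of_grcomp K k d d_gt0 n].
HB.instance Definition _ := [Choice of R_n by <:].
HB.instance Definition _ := [SubChoice_isSubLmodule of R_n by <:].

Definition wmonom : predArgType := {m : 'X_{1..k < n.+1} | wdeg d m == n}.

Lemma wmonomP (m : 'X_{1..k}) :
  wdeg d m = n -> {t : wmonom | val (val t) = m :> 'X_{1..k}}.
Proof.
move=> mn; have m_lt : (mdeg m < n.+1)%N.
  rewrite ltnS -mn mdegE; apply: leq_sum => i _.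
  by rewrite leq_pmull.
have h : wdeg d (BMultinom m_lt) == n by apply/eqP.
by exists (Sub (BMultinom m_lt) h : wmonom).
Qed.

Lemma grcomp_vecaxiom : vector_axiom #|{: wmonom}| R_n.
Proof.
pose M (i : 'I_#|{: wmonom}|) : 'X_{1..k} := val (val (enum_val i)).
have M_inj : injective M.
  by move=> i j /val_inj/val_inj/enum_val_inj.
pose f (p : R_n) := \row_i (val p)@_(M i).
exists f => /= [c p q|].
  by apply/matrixP=> i j; rewrite !mxE /= mcoeffD mcoeffZ.
pose g (r : 'rV[K]_(#|{: wmonom}|)) : {mpoly K[k]} := \sum_i r 0 i *: 'X_[M i].
have g_hom r : g r \is n.-homog for (wdeg d).
  rewrite rpred_sum //= => i _; apply/rpredZ.
  by rewrite dhomogX; exact: (valP (enum_val i)).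
have gE r j : (g r)@_(M j) = r 0 j.
  rewrite raddf_sum /= (bigD1 j) //= mcoeffZ mcoeffX eqxx mulr1.
  rewrite big1 ?addr0 // => i ne_ij.
  by rewrite mcoeffZ mcoeffX (inj_eq M_inj) (negbTE ne_ij) mulr0.
exists (fun r => GrComp d_gt0 (g_hom r)); last first.
  by move=> r; apply/rowP=> j; rewrite mxE gE.
move=> p; apply/val_inj/mpolyP=> m /=.
have p_hom : val p \is n.-homog for (wdeg d) by case: (p).
have [mn|mNn] := eqVneq (wdeg d m) n.
  have [t <-] := wmonomP mn.
  have -> : val (val t) = M (enum_rank t) by rewrite /M enum_rankK.
  by rewrite gE mxE.
by rewrite (dhomog_nemf_coeff (g_hom _)) // (dhomog_nemf_coeff p_hom).
Qed.

HB.instance Definition _ := Lmodule_hasFinDim.Build K R_n grcomp_vecaxiom.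

Definition hilbert_fun : nat := \dim {: R_n}.

Lemma hilbert_funE : hilbert_fun = #|{: wmonom}|.
Proof. by rewrite /hilbert_fun dimvf. Qed.

End GradedComponent.

Definition quasipoly (e : nat) : Type := {ffun 'I_e -> {poly rat}}.

(* The value P_i(n), for n congruent to i mod e.  The case None does not occur
   when 0 < e. *)
Definition qeval (e : nat) (P : quasipoly e) (n : nat) : rat :=
  if insub (n %% e)%N is Some i then (P i).[n%:R] else 0.

Definition qconst (e : nat) (Q : {poly rat}) : quasipoly e := [ffun=> Q].

(* With these conventions the zero (quasi-)polynomial has degree -1. *)
Definition pdegree (Q : {poly rat}) : int := (size Q)%:Z - 1.

Definition qdegree (e : nat) (P : quasipoly e) : int :=
  (\max_(i < e) size (P i))%:Z - 1.

Definition eventually_quasipoly (e : nat) (f : nat -> nat)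
    (P : quasipoly e) : Prop :=
  exists M : nat, forall n, (M <= n)%N -> (f n)%:R = qeval P n.

Lemma qevalE e (P : quasipoly e) (i : 'I_e) n :
  (n %% e = i)%N -> qeval P n = (P i).[n%:R].
Proof. by rewrite /qeval => ->; rewrite valK. Qed.

Lemma eventually_quasipoly_uniq e f (P Q : quasipoly e) : (0 < e)%N ->
  eventually_quasipoly f P -> eventually_quasipoly f Q -> P = Q.
Proof.
move=> e_gt0 [M PM] [N QN]; apply/ffunP => i; apply/eqP; rewrite -subr_eq0.
apply/negPn/negP => nz.
pose s := [seq ((i + (M + N + j) * e)%N)%:R : rat |
            j <- iota 0 (size (P i - Q i))].
have s_uniq : uniq s.
  rewrite map_inj_uniq ?iota_uniq // => j1 j2 /eqP; rewrite eqr_nat.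
  by rewrite eqn_add2l eqn_pmul2r // eqn_add2l => /eqP.
have s_root : all (root (P i - Q i)) s.
  apply/allP => x /mapP[j _ ->]; set n := (i + _)%N.
  have n_mod : (n %% e = i)%N by rewrite /n addnC modnMDl modn_small.
  have n_ge : (M + N <= n)%N.
    rewrite (leq_trans _ (leq_addl _ _)) // (leq_trans (leq_addr j _)) //.
    by rewrite leq_pmulr.
  rewrite rootE hornerD hornerN -(qevalE P n_mod) -(qevalE Q n_mod).
  by rewrite -PM ?QN ?subrr // (leq_trans _ n_ge) ?leq_addl ?leq_addr.
have := max_poly_roots nz s_root s_uniq.
by rewrite size_map size_iota ltnn.
Qed.

Lemma antidifference (c : nat) (p : {poly rat}) : (0 < c)%N ->
  {q : {poly rat} | q \Po ('X + c%:R%:P) - q = p}.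
Proof.
move=> c_gt0; have [n] := ubnP (size p); elim: n p => // n IHn p.
rewrite ltnS => p_le.
have [->|p_nz] := eqVneq p 0; first by exists 0; rewrite comp_poly0 subrr.
have [m sz_p] : {m | size p = m.+1}.
  by exists (size p).-1; rewrite prednK // lt0n size_poly_eq0.
have cnz : c%:R != 0 :> rat by rewrite pnatr_eq0 -lt0n.
pose q0 : {poly rat} := (p`_m / (m.+1%:R * c%:R)) *: 'X^(m.+1).
pose r := p - (q0 \Po ('X + c%:R%:P) - q0).
have r_lt : (size r < n)%N.
  apply: leq_trans p_le; rewrite sz_p ltnS.
  apply/leq_sizeP => j; rewrite /r /q0 comp_polyZ -scalerBr comp_Xn_poly.
  rewrite coefB coefZ coefB coefXn exprDn coef_sum.
  move=> m_le.
  have pj : p`_j = if j == m then p`_m else 0.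
    case: eqP => [->//|/eqP ne]; apply: nth_default.
    by rewrite sz_p ltn_neqAle eq_sym ne.
  have term (i : 'I_m.+2) :
      ('X^(m.+1 - i) * c%:R%:P ^+ i *+ 'C(m.+1, i) : {poly rat})`_j =
        if (j == m.+1 - i)%N then c%:R ^+ i *+ 'C(m.+1, i) else 0.
    rewrite coefMn -polyC_exp coefMC coefXn.
    by case: eqP => _; rewrite ?mul1r ?mul0r ?mul0rn.
  rewrite (eq_bigr _ (fun i _ => term i)) pj 2!big_ord_recl big1 => [|i _].
    rewrite /= subn0 expr0 bin0 bin1 subSS subn0 expr1 addr0.
    case: (ltngtP m j) m_le => [m_lt|//|<-] _.
      case: eqP => _; rewrite ?subr0 ?addr0 ?subrr ?mulr0 ?subr0 //.
    rewrite ltn_eqF // add0r subr0.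
    rewrite -[c%:R *+ _]mulr_natl divfK ?subrr //.
    by rewrite mulf_neq0 // pnatr_eq0.
  rewrite /= /bump /= !add1n subSS gtn_eqF // (leq_trans _ m_le) //.
  by rewrite ltn_subrL (leq_ltn_trans _ (ltn_ord i)).
have [q1 q1E] := IHn r r_lt.
exists (q0 + q1); rewrite comp_polyD opprD addrACA q1E /r.
by rewrite addrC subrK.
Qed.

(* The number of ways to write n as a sum of parts weighted by s; auxiliary to
   the existence of the Hilbert quasi-polynomial. *)
Fixpoint npart (s : seq nat) (n : nat) : nat :=
  if s is e :: s' then
    (\sum_(j < n.+1 | j * e <= n) npart s' (n - j * e))%N
  else n == 0%N.

Lemma npartD e s n : (0 < e)%N ->
  npart (e :: s) (n + e) = (npart s (n + e) + npart (e :: s) n)%N.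
Proof.
move=> e_gt0 /=; rewrite big_mkcond big_ord_recl /= mul0n subn0; congr addn.
rewrite [RHS](big_ord_widen_cond (n + e)
  (fun j => j * e <= n)%N (fun j => npart s (n - j * e))); last first.
  by rewrite -addn1 leq_add2l.
rewrite [RHS]big_mkcond; apply: eq_bigr => j _.
rewrite /bump /= add1n mulSn addnC leq_add2r subnDr.
case: (leqP (j * e) n) => //= jn.
by rewrite ltnS (leq_trans _ jn) // leq_pmulr.
Qed.

Lemma npart_coef s N n : all (ltn 0) s -> (n <= N)%N ->
  (\prod_(e <- s) \sum_(j < N.+1) 'X^(j * e) : {poly int})`_n = (npart s n)%:R.
Proof.
elim: s n => [|e s IHs] n /=; first by rewrite big_nil coef1.
case/andP=> e_gt0 s_gt0 n_le; rewrite big_cons mulr_suml coef_sum natr_sum.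
rewrite (big_ord_widen_cond N.+1
  (fun j => j * e <= n)%N (fun j => (npart s (n - j * e))%:R)) //.
rewrite [RHS]big_mkcond; apply: eq_bigr => j _; rewrite coefXnM ltnNge.
case: (leqP (j * e) n) => //= jn.
rewrite ltnS (leq_trans _ jn) ?leq_pmulr // IHs // (leq_trans _ n_le) //.
exact: leq_subr.
Qed.

Lemma hilbert_fun_npart (K : fieldType) k (d : 'I_k -> nat)
    (d_gt0 : forall i, (0 < d i)%N) n :
  hilbert_fun K d_gt0 n = npart [seq d i | i <- index_enum 'I_k] n.
Proof.
rewrite hilbert_funE; apply/eqP.
rewrite -(eqr_nat int) -(@npart_coef _ n) //; last first.
  by apply/allP=> _ /mapP[i _ ->]; exact: d_gt0.
rewrite big_map bigA_distr_bigA coef_sum /=.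
pose T := {f : {ffun 'I_k -> 'I_n.+1} | (\sum_i f i * d i == n)%N}.
have -> : #|{: wmonom d n}| = #|{: T}|.
  pose mon (f : {ffun 'I_k -> 'I_n.+1}) : 'X_{1..k} :=
    [multinom nat_of_ord (f i) | i < k].
  have monP (t : T) : wdeg d (mon (val t)) = n.
    rewrite -[RHS](eqP (valP t)); apply: eq_bigr => i _.
    by rewrite mnmE mulnC.
  have funP (t : wmonom d n) :
      (\sum_i [ffun i => inord (bmnm (val t) i) : 'I_n.+1] i * d i == n)%N.
    rewrite -[X in _ == X](eqP (valP t)); apply/eqP/eq_bigr => i _.
    rewrite ffunE inordK ?(mulnC (d i)) //.
    by rewrite (leq_ltn_trans _ (bmdeg (val t))) //
      mdegE (bigD1 i) //= leq_addr.
  apply/eqP; rewrite eqn_leq; apply/andP; split.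
    pose F t : T := Sub [ffun i => inord (bmnm (val t) i)] (funP t).
    suff F_inj : injective F by exact: (leq_card F F_inj).
    move=> t1 t2 /(congr1 val)/ffunP /= eq12.
    apply/val_inj/val_inj/mnmP => i.
    have lt (t : wmonom d n) : (bmnm (val t) i < n.+1)%N.
      by rewrite (leq_ltn_trans _ (bmdeg (val t))) //
      mdegE (bigD1 i) //= leq_addr.
    have /(congr1 val) := eq12 i; rewrite !ffunE /=.
    rewrite !inordK; [by []|exact: (lt t2)|exact: (lt t1)].
  pose G t := sval (wmonomP d_gt0 (monP t)).
  suff G_inj : injective G by exact: (leq_card G G_inj).
  move=> t1 t2; rewrite /G => eq12.
  have := svalP (wmonomP d_gt0 (monP t1)).
  rewrite eq12 (svalP (wmonomP d_gt0 (monP t2))) => /mnmP eqm.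
  apply/val_inj/ffunP => i; apply/val_inj; have := eqm i.
  by rewrite !mnmE.
rewrite card_sig -sum1_card natr_sum big_mkcond /=; apply/eqP/eq_bigr => f _.
rewrite -(big_morph _ (fun a b => exprD 'X a b) (expr0 'X)) coefXn inE eq_sym.
by case: eqP.
Qed.

Lemma quasipoly_rec e c (f g : nat -> nat) (P : quasipoly e) (M : nat) :
  (0 < e)%N -> (0 < c)%N -> (c %| e)%N ->
  (forall n, f (n + c)%N = (g (n + c) + f n)%N) ->
  (forall n, (M <= n)%N -> (g n)%:R = qeval P n) ->
  {Q : quasipoly e | forall n, ((M + e) * e <= n)%N -> (f n)%:R = qeval Q n}.
Proof.
move=> e_gt0 c_gt0 c_dvd fE gP.
pose ord n : 'I_e := Ordinal (ltn_pmod n e_gt0).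
pose G (i : 'I_e) : {poly rat} :=
  \sum_(j < e %/ c) (P (ord (i + j.+1 * c)%N) \Po ('X + (j.+1 * c)%:R%:P)).
have fG (i : 'I_e) n : (M <= n)%N -> (n %% e = i)%N ->
    (f (n + e)%N)%:R = (f n)%:R + (G i).[n%:R] :> rat.
  move=> n_ge n_mod; rewrite -{1}(divnK c_dvd) /G.
  elim: (e %/ c)%N => [|q IHq]; first by rewrite big_ord0 hornerC addr0 addn0.
  rewrite big_ord_recr hornerD addrA /= -IHq mulSnr addnA fE natrD addrC.
  congr (_ + _); rewrite gP; last first.
    by rewrite -addnA (leq_trans n_ge) // leq_addr.
  rewrite (@qevalE _ _ (ord (i + q.+1 * c)%N)); last first.
    by rewrite /= -n_mod modnDml -addnA -mulSnr.
  by rewrite horner_comp hornerD hornerX hornerC -natrD -addnA -mulSnr.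
pose A i := sval (antidifference (G i) e_gt0).
have AE i x : (A i).[x + e%:R] = (A i).[x] + (G i).[x].
  rewrite -[in RHS](svalP (antidifference (G i) e_gt0)) -/(A i) hornerD hornerN.
  by rewrite horner_comp hornerD hornerX hornerC [RHS]addrC subrK.
pose n0 (i : 'I_e) := (i + M * e)%N.
exists [ffun i => A i + ((f (n0 i))%:R - (A i).[(n0 i)%:R])%:P] => n n_ge.
rewrite (@qevalE _ _ (ord n)) // ffunE hornerD hornerC.
have [q ->] : exists q, n = (n0 (ord n) + q * e)%N.
  exists (n %/ e - M)%N; rewrite /n0 /= mulnBl -addnA subnKC.
    by rewrite addnC -divn_eq.
  rewrite leq_mul2r leq_divRL // (leq_trans _ n_ge) ?orbT //.
  by rewrite leq_mul2r leq_addr orbT.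
set i := ord n.
have -> : ord (n0 i + q * e)%N = i.
  by apply/val_inj; rewrite /= /n0 -addnA -mulnDl addnC modnMDl modn_mod.
elim: q => [|q IHq]; first by rewrite mul0n addn0 addrC subrK.
rewrite mulSnr addnA (fG i); first 1 last.
- by rewrite (leq_trans _ (leq_addr _ _)) //
    (leq_trans _ (leq_addl _ _)) // leq_pmulr.
- by rewrite /n0 -addnA -mulnDl addnC modnMDl modn_small.
by rewrite (natrD _ _ e) AE IHq addrAC.
Qed.

Lemma npart_quasipoly e s : (0 < e)%N -> all (ltn 0) s -> all (dvdn^~ e) s ->
  {PM : quasipoly e * nat |
    forall n, (PM.2 <= n)%N -> (npart s n)%:R = qeval PM.1 n}.
Proof.
move=> e_gt0; elim: s => [|c s IHs] /=.
  move=> _ _; exists (0, 1%N) => n /= n_gt0.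
  rewrite (@qevalE _ _ (Ordinal (ltn_pmod n e_gt0))) // ffunE horner0.
  by rewrite eqn0Ngt n_gt0.
case/andP=> c_gt0 s_gt0 /andP[c_dvd s_dvd].
have [[P M] PM] := IHs s_gt0 s_dvd.
have [Q QP] := quasipoly_rec e_gt0 c_gt0 c_dvd (fun n => npartD s n c_gt0) PM.
by exists (Q, ((M + e) * e)%N).
Qed.

Lemma wlcm_gt0 k (d : 'I_k -> nat) : (forall i, (0 < d i)%N) -> (0 < wlcm d)%N.
Proof.
move=> d_gt0; rewrite /wlcm; elim/big_ind: _ => // x y x_gt0 y_gt0.
by rewrite lcmn_gt0 x_gt0.
Qed.

Section HilbertQuasiPolynomial.
Variables (K : fieldType) (k : nat) (d : 'I_k -> nat).
Hypothesis d_gt0 : forall i, (0 < d i)%N.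

Lemma hilbert_quasipoly_exists :
  {P : quasipoly (wlcm d) | eventually_quasipoly (hilbert_fun K d_gt0) P}.
Proof.
have [||[P M] PM] := @npart_quasipoly _ [seq d i | i <- index_enum 'I_k]
    (wlcm_gt0 d_gt0).
- by apply/allP=> _ /mapP[i _ ->]; exact: d_gt0.
- by apply/allP=> _ /mapP[i _ ->]; exact: (biglcmn_sup i).
by exists P; exists M => n n_ge; rewrite hilbert_fun_npart PM.
Qed.

Definition hilbert_quasipoly : quasipoly (wlcm d) :=
  sval hilbert_quasipoly_exists.

Lemma hilbert_quasipolyP :
  eventually_quasipoly (hilbert_fun K d_gt0) hilbert_quasipoly.
Proof. exact: (svalP hilbert_quasipoly_exists). Qed.

Lemma hilbert_quasipoly_unique (P : quasipoly (wlcm d)) :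
  eventually_quasipoly (hilbert_fun K d_gt0) P -> P = hilbert_quasipoly.
Proof.
move=> PP.
by apply: eventually_quasipoly_uniq (wlcm_gt0 d_gt0) PP hilbert_quasipolyP.
Qed.

End HilbertQuasiPolynomial.

(* Main.v *)
From HB Require Import structures.
Require Import Defs.
From mathcomp Require Import all_boot all_order all_algebra all_field.

Set Implicit Arguments.
Unset Strict Implicit.
Unset Printing Implicit Defensive.

Import Order.TTheory GRing.Theory Num.Theory.
Local Open Scope ring_scope.

(** Write H n for the number of monomials of weighted degree n, e for the lcm of
    the weights d_i and delta for [wdelta d].  The generating series of H is the
    inverse of the product of the 1 - t^(d_i).  At t = 1 it has a pole of order
    k, and at another root of unity, of order m > 1, a pole whose order is the
    number of d_i divisible by m, hence at most delta.  The pole at 1 gives the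
    polynomial Q, the other poles give the quasi-polynomial S.

    The proof runs this argument on linear recurrences.  The sequence H is
    encoded as the linear form L on Q[X] that sends X^n to H n ([umbral]), so
    that multiplication by X is the shift of the sequence.  Put y = X - 1 and
    let V be the product of the geom d_i = 1 + X + ... + X^(d_i - 1), so that
    the product of the X^(d_i) - 1 is y^k V.
    - The recurrence of H, one weight at a time, gives
      L (y^(k-1) V q) = q(1) for all q ([umbral_npart]); therefore L vanishes
      on the multiples of y^k V.
    - Factoring into cyclotomic polynomials shows that V divides
      (X^e - 1)^delta ([dvdp_prod_geom]): a primitive m-th root of unity is a
      root of V with multiplicity the number of d_i divisible by m, and these
      d_i have a gcd different from 1.
    - V(1) is not 0, so u y^k + v V = 1 for some u and v, and
      H n = L (v V X^n) + L (u y^k X^n).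
    - By Newton's expansion ([umbral_newton]), a sequence killed by y^m is a
      polynomial of degree < m in n.  The sequence L (v V X^n) is killed by
      y^k, and L (v V y^(k-1)) = v(1) is not 0: it is a polynomial of degree
      exactly k - 1.  The sequence L (u y^k X^n) is killed by (X^e - 1)^delta:
      on each residue class modulo e it is a polynomial of degree < delta.

    The pair (Q, S) is not unique: a polynomial may be moved between Q and S.
    Since the d_i have gcd 1, delta < k, so that adding X^(delta - 1) to S and
    subtracting it from Q keeps the degree of Q; this brings the degree of S to
    exactly delta - 1 when it is smaller. *)

(** * Sequences as linear forms on polynomials *)

(** The umbral linear form, which maps 'X^n to f n.  A polynomial w is the
    operator sum_j w_j E^j, with E the shift: w kills the sequence f when the
    form vanishes on all multiples of w. *)
Definition umbral (f : nat -> rat) (p : {poly rat}) : rat :=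
  \sum_(j < size p) p`_j * f j.

Lemma umbral_widen f (p : {poly rat}) m :
  (size p <= m)%N -> umbral f p = \sum_(j < m) p`_j * f j.
Proof.
move=> p_le.
rewrite /umbral (@big_ord_widen _ _ _ _ m (fun j => p`_j * f j)) //.
rewrite big_mkcond; apply: eq_bigr => j _; case: ltnP => // /(nth_default 0)->.
by rewrite mul0r.
Qed.

Lemma umbral_is_linear f : linear_for *%R (umbral f).
Proof.
move=> a p q; set m := maxn (size p) (size q).
have p_le : (size p <= m)%N by exact: leq_maxl.
have q_le : (size q <= m)%N by exact: leq_maxr.
have pq_le : (size (a *: p + q)%R <= m)%N.
  rewrite (leq_trans (size_polyD _ _)) // geq_max q_le.
  by rewrite (leq_trans (size_scale_leq _ _)).
rewrite !(@umbral_widen f _ m) // mulr_sumr -big_split /=.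
by apply: eq_bigr => j _; rewrite coefD coefZ mulrDl mulrA.
Qed.

HB.instance Definition _ f := GRing.isLinear.Build rat {poly rat} rat *%R
  (umbral f) (umbral_is_linear f).

Lemma umbralXnM f e q :
  umbral f ('X^e * q) = \sum_(j < size q) q`_j * f (j + e)%N.
Proof.
rewrite (@umbral_widen _ _ (e + size q)); last first.
  by rewrite (leq_trans (size_polyMleq _ _)) // size_polyXn.
rewrite big_split_ord /= big1 ?add0r => [|j _]; last first.
  by rewrite coefXnM ltn_ord mul0r.
by apply: eq_bigr => j _; rewrite coefXnM ltnNge leq_addr /= addKn addnC.
Qed.

Lemma umbralXn f n : umbral f 'X^n = f n.
Proof.
by rewrite -['X^n]mulr1 umbralXnM size_poly1 big_ord1 coef1 mul1r.
Qed.

(** * The recurrences of the partition counts *)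

Definition geom (c : nat) : {poly rat} := \sum_(j < c) 'X^j.

Lemma geomE c : 'X^c - 1 = ('X - 1) * geom c.
Proof. exact: subrX1. Qed.

Lemma horner_geom1 c : (geom c).[1] = c%:R.
Proof.
rewrite horner_sum (eq_bigr (fun=> 1)) => [|j _].
  by rewrite sumr_const card_ord.
by rewrite hornerXn expr1n.
Qed.

Definition npartr (s : seq nat) (n : nat) : rat := (npart s n)%:R.

(** A partition of n + c with parts in c :: s either does not use c, or comes
    from a partition of n by adding one part c. *)
Lemma umbral_npart_cons c s q : (0 < c)%N ->
  umbral (npartr (c :: s)) (('X^c - 1) * q) = umbral (npartr s) ('X^c * q).
Proof.
move=> c_gt0; rewrite mulrBl mul1r raddfB /= !umbralXnM /umbral -sumrB.
apply: eq_bigr => j _; rewrite -mulrBr; congr (_ * _).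
by rewrite /npartr npartD // natrD addrK.
Qed.

Lemma umbral_npart1 c : (0 < c)%N -> umbral (npartr [:: c]) (geom c) = 1.
Proof.
(* Among 0, ..., c - 1, only 0 is a sum of parts equal to c. *)
case: c => // c _; rewrite /geom raddf_sum big_ord_recl big1 /= => [|j _].
  by rewrite umbralXn /npartr /= big_mkcond big_ord_recl big_ord0 addr0.
rewrite umbralXn /npartr /= big_mkcond big_ord_recl /= big1 ?addn0 //.
move=> i _; rewrite /bump /= !add1n mulSn addSn ltnS.
case: leqP => // le_ij; have := leq_trans (leq_addr _ _) le_ij.
by rewrite leqNgt ltn_ord.
Qed.

(** This is the leading behaviour of the pole at 1: one factor 'X - 1 less than
    in the full recurrence leaves the constant sequence 1.  Removing the weight
    c costs a factor 'X^c - 1 and leaves a shift by c, which does not change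
    q.[1]; so everything reduces to a single weight c, whose partition counts
    are the indicator of the multiples of c. *)
Lemma umbral_npart s q : all (ltn 0) s -> s != [::] ->
  umbral (npartr s) (('X - 1) ^+ (size s).-1 * \prod_(c <- s) geom c * q)
  = q.[1].
Proof.
elim: s q => // c [|c' s] IHs q /=; first rewrite andbT => c_gt0 _.
  rewrite expr0 mul1r big_seq1.
  (* The multiple of 'X - 1 in q is killed, because 'X^c - 1 then appears. *)
  have /factor_theorem[r rE] : root (q - q.[1]%:P) 1.
    by rewrite rootE !hornerE subrr.
  have -> : q = q.[1] *: 1 + ('X - 1) * r.
    by rewrite alg_polyC mulrC -rE addrC subrK.
  rewrite mulrDr raddfD /= -scalerAr mulr1 linearZ /= mulrA [geom c * _]mulrC.
  rewrite -geomE umbral_npart_cons // umbralXnM big1 => [|j _]; last first.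
    by rewrite /npartr /= addn_eq0 -[c == 0%N]negbK -lt0n c_gt0 andbF mulr0.
  by rewrite !hornerE umbral_npart1 // mulr1.
case/andP=> c_gt0 s_gt0 _; rewrite big_cons exprS.
set u := (_ ^+ _); set V := \prod_(_ <- _) _.
have -> : ('X - 1) * u * (geom c * V) * q = ('X^c - 1) * (u * V * q).
  by rewrite geomE -!mulrA; congr (_ * _); rewrite mulrCA.
by rewrite umbral_npart_cons // mulrCA IHs // hornerM hornerXn expr1n mul1r.
Qed.

Lemma umbral_npart0 s q : all (ltn 0) s -> s != [::] ->
  umbral (npartr s) (('X - 1) ^+ size s * \prod_(c <- s) geom c * q) = 0.
Proof.
move=> s_gt0 s_nz; have -> : size s = (size s).-1.+1 by case: s s_nz {s_gt0}.
rewrite exprSr -(mulrA _ ('X - 1)) [('X - 1) * _]mulrC mulrA -mulrA.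
by rewrite umbral_npart // hornerM !hornerE.
Qed.

(** * Newton's expansion *)

Definition binpoly (j : nat) : {poly rat} :=
  (j`!%:R)^-1 *: \prod_(i < j) ('X - (i%:R)%:P).

Lemma binpolyE j n : (binpoly j).[n%:R] = 'C(n, j)%:R.
Proof.
rewrite hornerZ horner_prod.
have -> : \prod_(i < j) ('X - i%:R%:P).[n%:R] = (n ^_ j)%:R :> rat.
  elim: j => [|j IHj]; first by rewrite big_ord0 ffactn0.
  rewrite big_ord_recr /= IHj ffactnSr natrM !hornerE.
  case: (leqP j n) => [le_jn|lt_nj]; first by rewrite natrB.
  by rewrite ffact_small // !mul0r.
by rewrite -bin_ffact natrM mulrC mulfK // pnatr_eq0 -lt0n fact_gt0.
Qed.

Lemma size_binpoly j : size (binpoly j) = j.+1.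
Proof.
rewrite size_scale ?invr_eq0 ?pnatr_eq0 -?lt0n ?fact_gt0 //.
by rewrite size_prod_XsubC /index_enum -enumT size_enum_ord.
Qed.

Definition newton (m : nat) (c : nat -> rat) : {poly rat} :=
  \sum_(j < m) c j *: binpoly j.

Lemma size_newton m c : (size (newton m c) <= m)%N.
Proof.
apply: (leq_trans (size_sum _ _ _)); apply/bigmax_leqP=> j _.
by rewrite (leq_trans (size_scale_leq _ _)) // size_binpoly.
Qed.

Lemma size_newtonS m c : c m != 0 -> size (newton m.+1 c) = m.+1.
Proof.
move=> cm; have sz : size (c m *: binpoly m) = m.+1.
  by rewrite size_scale // size_binpoly.
by rewrite /newton big_ord_recr /= addrC size_polyDl sz // ltnS size_newton.
Qed.

(** Expand y ^+ n = (1 + (y - 1)) ^+ n by the binomial formula.  The use of a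
    general y serves both parts of the decomposition: y = 'X for the polynomial
    part, and y = 'X^e to follow a residue class modulo e. *)
Lemma umbral_newton f w y m n :
  (forall j, (m <= j)%N -> umbral f (w * (y - 1) ^+ j) = 0) ->
  umbral f (w * y ^+ n)
  = (newton m (fun j => umbral f (w * (y - 1) ^+ j))).[n%:R].
Proof.
move=> w_kill; set c := fun j => _.
have -> : umbral f (w * y ^+ n) = \sum_(0 <= j < n.+1) c j * 'C(n, j)%:R.
  rewrite -[in LHS](subrK 1 y) addrC exprDn mulr_sumr raddf_sum big_mkord /=.
  apply: eq_bigr => j _.
  by rewrite expr1n mul1r mulr_natr mulrnAr raddfMn.
rewrite /newton horner_sum.
rewrite -(big_mkord xpredT (fun j => (c j *: binpoly j).[n%:R])).
under [RHS]eq_bigr => j _ do rewrite hornerZ binpolyE.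
(* The sums over j < n.+1 and over j < m agree, since the terms vanish beyond
   either bound. *)
have cat0 a F : (a <= m + n.+1)%N -> (forall j, (a <= j)%N -> F j = 0) ->
    \sum_(0 <= j < a) F j = \sum_(0 <= j < m + n.+1) F j :> rat.
  move=> a_le F0; rewrite [RHS](big_cat_nat _ a_le) //=.
  rewrite [X in _ + X]big_nat_cond [X in _ + X]big1 ?addr0 // => j.
  by rewrite andbT => /andP[/F0].
rewrite [LHS]cat0 ?leq_addl // => [|j n_lt]; last by rewrite bin_small ?mulr0.
by rewrite [RHS]cat0 ?leq_addr // => j m_le; rewrite /c w_kill ?mul0r.
Qed.

(** * Cyclotomic factors *)

Definition ratCyclotomic (m : nat) : {poly rat} := map_poly intr 'Phi_m.

Lemma prod_ratCyclotomic c : (0 < c)%N ->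
  \prod_(m <- divisors c) ratCyclotomic m = 'X^c - 1.
Proof.
move=> c_gt0; rewrite -rmorph_prod /= prod_Cyclotomic //.
by rewrite rmorphB rmorph1 /= map_polyXn.
Qed.

Lemma geom_Cyclotomic c : (0 < c)%N ->
  geom c = \prod_(m <- divisors c | m != 1%N) ratCyclotomic m.
Proof.
move=> c_gt0; have X1_nz : 'X - 1 != 0 :> {poly rat}.
  by rewrite -polyC1 polyXsubC_eq0.
apply: (mulfI X1_nz); rewrite -geomE -prod_ratCyclotomic //.
rewrite (bigD1_seq 1%N) ?divisors_uniq -?dvdn_divisors ?dvd1n //=.
by rewrite -['X - 1](@prod_ratCyclotomic 1) // big_seq1.
Qed.

(** The cyclotomic polynomial of index m != 1 occurs in the product once for
    each i such that m divides d i, and exactly once in geom e when m divides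
    e. *)
Lemma dvdp_prod_geom (I : finType) (d : I -> nat) e n : (0 < e)%N ->
  (forall i, d i %| e)%N ->
  (forall m, m != 1%N -> (#|[set i | (m %| d i)%N]| <= n)%N) ->
  \prod_i geom (d i) %| ('X^e - 1) ^+ n.
Proof.
move=> e_gt0 d_dvd card_le.
have d_gt0 i : (0 < d i)%N := dvdn_gt0 e_gt0 (d_dvd i).
rewrite geomE exprMn; apply: dvdp_mull.
have -> : \prod_i geom (d i) = \prod_(m <- divisors e | m != 1%N)
    ratCyclotomic m ^+ #|[set i | (m %| d i)%N]|.
  have geom_e i : geom (d i) = \prod_(m <- divisors e | m != 1%N)
      (if (m %| d i)%N then ratCyclotomic m else 1).
    rewrite -big_mkcondr geom_Cyclotomic // -big_filter -[RHS]big_filter.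
    apply/perm_big/uniq_perm; rewrite ?filter_uniq ?divisors_uniq // => m.
    rewrite !mem_filter -!dvdn_divisors // -andbA; congr (_ && _).
    by case: (boolP (m %| d i)%N) => // /dvdn_trans->.
  rewrite (eq_bigr _ (fun i _ => geom_e i)) exchange_big /=.
  apply: eq_bigr => m _; rewrite -big_mkcond /= prodr_const.
  by congr (_ ^+ _); apply: eq_card => i; rewrite !inE.
rewrite geom_Cyclotomic // -prodrXl.
elim/big_ind2: _ => [|p1 q1 p2 q2|m m_neq1]; first exact: dvdpp.
  exact: dvdp_mul.
by rewrite dvdp_exp2l // card_le.
Qed.

(** * The decomposition *)

Lemma wdelta_ge k (d : 'I_k -> nat) m : m != 1%N ->
  (#|[set i | (m %| d i)%N]| <= wdelta d)%N.
Proof.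
move=> m_neq1; apply: (@leq_bigmax_cond _ _ (fun I : {set 'I_k} => #|I|)).
apply: contraNneq m_neq1 => gcd1; rewrite -dvdn1 -gcd1.
by apply/dvdn_biggcdP => i; rewrite inE.
Qed.

Lemma wdelta_lt k (d : 'I_k -> nat) : wgcd d = 1%N -> (wdelta d < k)%N.
Proof.
case: k d => [|k] d d_gcd; first by move: d_gcd; rewrite /wgcd big_ord0.
rewrite ltnS; apply/bigmax_leqP => I; apply: contraR; rewrite -ltnNge => I_gt.
have -> : I = setT.
  by apply/eqP; rewrite eqEcard subsetT cardsT card_ord.
by rewrite -d_gcd; apply/eqP/eq_bigl => i; rewrite inE.
Qed.

(** The component of index i has to be evaluated at i + e a rather than at a,
    whence the affine change of variable, which preserves the degree. *)
Lemma quasipoly_interleave e (f : nat -> rat) (r : 'I_e -> {poly rat}) n :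
  (0 < e)%N -> (forall i, (size (r i) <= n)%N) ->
  (forall (i : 'I_e) a, f (i + e * a)%N = (r i).[a%:R]) ->
  exists2 S : quasipoly e, (forall i, (size (S i) <= n)%N) & f =1 qeval S.
Proof.
move=> e_gt0 r_le fr; have e_nz : e%:R != 0 :> rat by rewrite pnatr_eq0 -lt0n.
exists [ffun i : 'I_e => r i \Po ((e%:R)^-1 *: ('X - (i%:R)%:P))] => [i|m].
  rewrite ffunE size_comp_poly2 // size_scale ?invr_eq0 //.
  exact: size_XsubC.
have m_lt := ltn_pmod m e_gt0; rewrite (@qevalE _ _ (Ordinal m_lt)) // ffunE.
rewrite horner_comp !hornerE {1 3}(divn_eq m e) addnC [(_ * e)%N]mulnC.
rewrite -[(m %% e)%N]/(nat_of_ord (Ordinal m_lt)) fr /=.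
by rewrite natrD addrAC subrr add0r natrM mulKf.
Qed.

(** The two summands come from a Bezout relation between the part of the
    recurrence supported at 1 and the rest. *)
Lemma npart_decomposition k (d : 'I_k -> nat) :
  (forall i, (0 < d i)%N) -> (0 < k)%N ->
  exists (Q : {poly rat}) (S : quasipoly (wlcm d)),
    [/\ forall n, npartr [seq d i | i <- index_enum 'I_k] n
                  = Q.[n%:R] + qeval S n,
        size Q = k & forall i, (size (S i) <= wdelta d)%N].
Proof.
move=> d_gt0 k_gt0; have e_gt0 := wlcm_gt0 d_gt0; set e := wlcm d in e_gt0 *.
set s := map d _; set L := umbral (npartr s).
have s_size : size s = k by rewrite size_map /index_enum -enumT size_enum_ord.
have s_gt0 : all (ltn 0) s by apply/allP=> _ /mapP[i _ ->]; exact: d_gt0.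
have s_nz : s != [::] by rewrite -size_eq0 s_size -lt0n.
pose V := \prod_i geom (d i); pose y : {poly rat} := 'X - 1.
have prod_s : \prod_(c <- s) geom c = V by rewrite big_map.
have L_y q : L (y ^+ k.-1 * V * q) = q.[1].
  by rewrite -prod_s -s_size; apply: umbral_npart.
have L0 p : y ^+ k * V %| p -> L p = 0.
  by move=> /dvdpP[q ->]; rewrite mulrC -prod_s -s_size; apply: umbral_npart0.
have V_dvd : V %| ('X^e - 1) ^+ wdelta d.
  apply: dvdp_prod_geom => // [i|m]; last exact: wdelta_ge.
  exact: (biglcmn_sup i).
have V1 : V.[1] != 0.
  rewrite horner_prod; apply/prodf_neq0 => i _.
  by rewrite horner_geom1 pnatr_eq0 -lt0n.
have /Bezout_eq1_coprimepP[[u v] /= uv1] : coprimep (y ^+ k) V.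
  by rewrite coprimep_expl // /y -polyC1 coprimep_sym coprimep_XsubC rootE.
pose wQ := v * V; pose wS := u * y ^+ k.
pose cQ j := L (wQ * y ^+ j).
pose cS (i : 'I_e) j := L (wS * 'X^i * ('X^e - 1) ^+ j).
have QE n : L (wQ * 'X^n) = (newton k cQ).[n%:R].
  apply: umbral_newton => j k_le; apply: L0.
  by rewrite mulrC dvdp_mul ?dvdp_exp2l // dvdp_mulIr.
have SE (i : 'I_e) a :
    L (wS * 'X^(i + e * a)) = (newton (wdelta d) (cS i)).[a%:R].
  rewrite exprD exprM mulrA; apply: umbral_newton => j le_j; apply: L0.
  rewrite dvdp_mul ?(dvdp_trans V_dvd) ?dvdp_exp2l //.
  by rewrite -mulrA mulrCA dvdp_mulIl.
have [S S_le fS] := quasipoly_interleave (f := fun n => L (wS * 'X^n)) e_gt0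
  (fun i => size_newton (wdelta d) (cS i)) SE.
exists (newton k cQ), S; split=> // [n|].
  rewrite -QE -fS -[LHS](umbralXn (npartr s)) /L -raddfD /= -mulrDl.
  by rewrite [wQ + wS]addrC uv1 mul1r.
(* The coefficient of degree k.-1 in Newton's expansion is a nonzero multiple
   of L (v * V * y ^+ k.-1) = v.[1], and the Bezout relation at 1 reads
   v.[1] * V.[1] = 1. *)
rewrite -[in newton k](prednK k_gt0) size_newtonS ?prednK //.
rewrite /cQ -(_ : y ^+ k.-1 * V * v = wQ * y ^+ k.-1) ?L_y; last first.
  by rewrite /wQ mulrC mulrCA mulrC.
have /(congr1 (horner^~ 1)) := uv1.
rewrite /= /y !hornerE subrr expr0n gtn_eqF // mulr0 add0r.
by apply: contra_eq_neq => ->; rewrite mul0r eq_sym oner_eq0.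
Qed.

Lemma size_qconstD e (S : quasipoly e) n : (0 < e)%N ->
  (\max_(i < e) size (S i) <= n)%N ->
  (\max_(i < e) size ((S + qconst e 'X^n)%R i) = n.+1)%N.
Proof.
move=> e_gt0 /bigmax_leqP S_le.
have sizeE i : size ((S + qconst e 'X^n) i) = n.+1.
  by rewrite !ffunE addrC size_polyDl size_polyXn // ltnS S_le.
apply/eqP; rewrite eqn_leq; apply/andP; split.
  by apply/bigmax_leqP => i _; rewrite sizeE.
by rewrite -(sizeE (Ordinal e_gt0)); apply: leq_bigmax.
Qed.

Theorem proposition17 (K : fieldType) (k : nat) (d : 'I_k -> nat)
    (d_gt0 : forall i : 'I_k, (0 < d i)%N) (d_gcd : wgcd d = 1%N) :
  exists (Q : {poly rat}) (S : quasipoly (wlcm d)),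
    [/\ hilbert_quasipoly K d_gt0 = qconst (wlcm d) Q + S,
        pdegree Q = k%:Z - 1
      & qdegree S = (wdelta d)%:Z - 1].
Proof.
have delta_lt := wdelta_lt d_gcd; have e_gt0 := wlcm_gt0 d_gt0.
have [Q [S [QS Q_size S_le]]] :=
  npart_decomposition d_gt0 (leq_ltn_trans (leq0n _) delta_lt).
have hilbertE : hilbert_quasipoly K d_gt0 = qconst (wlcm d) Q + S.
  apply/esym/hilbert_quasipoly_unique; exists 0%N => n _.
  rewrite hilbert_fun_npart [LHS]QS.
  by rewrite !(@qevalE _ _ (Ordinal (ltn_pmod n e_gt0))) // !ffunE hornerD.
have : (\max_(i < wlcm d) size (S i) <= wdelta d)%N by apply/bigmax_leqP.
rewrite leq_eqVlt => /predU1P[S_size|].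
  by exists Q, S; rewrite /pdegree /qdegree Q_size S_size.
case delta: (wdelta d) => [//|n] S_lt.
(* Here S has degree < n with n = (wdelta d).-1; the term 'X^n is moved from Q
   to S, and n < k.-1 keeps the degree of Q. *)
exists (Q - 'X^n), (S + qconst (wlcm d) 'X^n); split.
- rewrite hilbertE; apply/ffunP=> i.
  by rewrite !ffunE [S i + _]addrC addrA subrK.
- rewrite /pdegree size_polyDl ?Q_size // size_polyN size_polyXn.
  by rewrite -delta.
by rewrite /qdegree size_qconstD.
Qed.
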